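(* Let $\alpha,\beta\in\mathbb{R}$. The double inequality $$\alpha C(a,b)+(1-\alpha)H(a,b)<T(a,b)<\beta C(a,b)+(1-\beta)H(a,b)$$ holds for all real $a,b>0$ with $a\ne b$ if and only if $\alpha\le \frac{2}{\pi}$ and $\beta\ge \frac{2}{3}$.
   Context: For real numbers $a,b>0$ with $a\neq b$: the contra-harmonic mean is $C(a,b)=\frac{a^2+b^2}{a+b}$; the harmonic mean is $H(a,b)=\frac{2ab}{a+b}$; the second Seiffert mean is $T(a,b)=\frac{a-b}{2\arctan\left(\frac{a-b}{a+b}\right)}$. *)

(* Defs.v *)
From Stdlib Require Import Reals.
Open Scope R_scope.

Definition contraharmonic_mean (a b : R) : R := (a ^ 2 + b ^ 2) / (a + b).

Definition harmonic_mean (a b : R) : R := 2 * a * b / (a + b).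

(* Meaningful only for positive [a <> b]; at [a = b] the denominator vanishes. *)
Definition second_seiffert_mean (a b : R) : R :=
  (a - b) / (2 * atan ((a - b) / (a + b))).

(* Main.v *)
Require Import Defs.
From Stdlib Require Import Reals Lra.
From Coquelicot Require Import Coquelicot.
Open Scope R_scope.

(** Put [t = (a - b) / (a + b)].  After division by the arithmetic mean
    [(a + b) / 2], the means C, H and T become [1 + t^2], [1 - t^2] and
    [t / atan t], so that a combination of C and H with weight [alpha] becomes
    [1 + k t^2] with [k = 2 alpha - 1].  By symmetry the theorem says for which
    [k] the parabola [1 + k t^2] lies below, or above, [t / atan t] on the whole
    interval (0, 1) ([mean_bounds_iff_parabola_bounds]).

    For [k >= 0] the comparison is decided by the sign of
    [seiffert_gap k t = t / (1 + k t^2) - atan t], which vanishes at 0 and whose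
    derivative has the sign of [(1 - 3 k) - k (1 + k) t^2].
    - For [k = 1/3] ([beta = 2/3]) the derivative is negative, hence so is the
      gap.
    - For [0 <= k < 1/3] the derivative is positive near 0, hence so is the gap,
      and no [beta < 2/3] can work.
    - For [k = 4/PI - 1] ([alpha = 2/PI]) the gap also vanishes at 1.  The sign
      factor is decreasing in [t], so the gap rises and then falls between its
      two zeros and is positive in between.
    Letting [t] tend to 1 in [1 + k t^2 < t / atan t] gives [1 + k <= 4/PI],
    so no [alpha > 2/PI] can work.  All other weights follow because
    [1 + k t^2] is increasing in [k]. *)

(** * Reduction to one variable *)

Lemma atan_pos (t : R) : 0 < t -> 0 < atan t.
Proof. intros Ht; rewrite <- atan_0; now apply atan_increasing. Qed.

Lemma contraharmonic_harmonic_combination (alpha a b : R) : 0 < a -> 0 < b ->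
  alpha * contraharmonic_mean a b + (1 - alpha) * harmonic_mean a b
  = (a + b) / 2 * (1 + (2 * alpha - 1) * ((a - b) / (a + b)) ^ 2).
Proof.
intros Ha Hb; unfold contraharmonic_mean, harmonic_mean; field; lra.
Qed.

Lemma second_seiffert_mean_ratio (a b : R) : 0 < b -> b < a ->
  second_seiffert_mean a b
  = (a + b) / 2 * ((a - b) / (a + b) / atan ((a - b) / (a + b))).
Proof.
intros Hb Hab; unfold second_seiffert_mean.
assert (Hp : 0 < atan ((a - b) / (a + b))).
{ apply atan_pos, Rdiv_lt_0_compat; lra. }
field; lra.
Qed.

Lemma second_seiffert_mean_sym (a b : R) :
  second_seiffert_mean a b = second_seiffert_mean b a.
Proof.
unfold second_seiffert_mean.
replace ((a - b) / (a + b)) with (- ((b - a) / (b + a)))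
  by (rewrite (Rplus_comm b a); unfold Rdiv; ring).
rewrite atan_opp.
replace (2 * - atan ((b - a) / (b + a)))
  with (- (2 * atan ((b - a) / (b + a)))) by ring.
unfold Rdiv; rewrite Rinv_opp; ring.
Qed.

(** The pair [(1 + t, 1 - t)] has arithmetic mean 1 and ratio [t], which gives
    the direct implication; conversely the problem is homogeneous and
    symmetric in [a] and [b]. *)
Lemma mean_bounds_iff_parabola_bounds (alpha beta : R) :
  (forall a b : R, 0 < a -> 0 < b -> a <> b ->
     alpha * contraharmonic_mean a b + (1 - alpha) * harmonic_mean a b
       < second_seiffert_mean a b
       < beta * contraharmonic_mean a b + (1 - beta) * harmonic_mean a b)
  <-> (forall t : R, 0 < t < 1 ->
     1 + (2 * alpha - 1) * t ^ 2 < t / atan t < 1 + (2 * beta - 1) * t ^ 2).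
Proof.
split.
- intros H t Ht.
  specialize (H (1 + t) (1 - t) ltac:(lra) ltac:(lra) ltac:(lra)).
  rewrite !contraharmonic_harmonic_combination in H by lra.
  rewrite second_seiffert_mean_ratio in H by lra.
  replace ((1 + t - (1 - t)) / (1 + t + (1 - t))) with t in H by (field; lra).
  lra.
- intros H.
  assert (Hlt : forall a b, 0 < b -> b < a ->
     alpha * contraharmonic_mean a b + (1 - alpha) * harmonic_mean a b
       < second_seiffert_mean a b
       < beta * contraharmonic_mean a b + (1 - beta) * harmonic_mean a b).
  { intros a b Hb Hab.
    rewrite !contraharmonic_harmonic_combination by lra.
    rewrite second_seiffert_mean_ratio by lra.
    assert (Ht : 0 < (a - b) / (a + b) < 1).
    { split; [apply Rdiv_lt_0_compat; lra|].
      apply Rmult_lt_reg_r with (a + b); [lra|].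
      unfold Rdiv; rewrite Rmult_assoc, Rinv_l; lra. }
    destruct (H _ Ht) as [Hl Hu].
    split; apply Rmult_lt_compat_l; lra. }
  intros a b Ha Hb Hab.
  destruct (Rtotal_order a b) as [Hl | [He | Hg]].
  + rewrite second_seiffert_mean_sym.
    rewrite !contraharmonic_harmonic_combination by lra.
    replace ((a - b) / (a + b)) with (- ((b - a) / (b + a)))
      by (field; lra).
    rewrite (Rplus_comm a b), <- !Rsqr_pow2, <- !Rsqr_neg, !Rsqr_pow2.
    rewrite <- !contraharmonic_harmonic_combination by lra.
    now apply Hlt.
  + contradiction.
  + now apply Hlt.
Qed.

(** * The gap between a rational function and the arctangent *)

Definition seiffert_gap (k t : R) : R := t / (1 + k * t ^ 2) - atan t.

Lemma parabola_pos (k t : R) : 0 <= k -> 0 < 1 + k * t ^ 2.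
Proof. intros Hk; pose proof (pow2_ge_0 t); nra. Qed.

Lemma seiffert_gap_0 (k : R) : seiffert_gap k 0 = 0.
Proof. unfold seiffert_gap; rewrite atan_0; field; lra. Qed.

(** The comparison is one between [t / (1 + k t^2)] and [atan t] after
    exchanging denominators, both of which are positive. *)
Lemma parabola_sub_ratio (k t : R) : 0 <= k -> 0 < t ->
  t / atan t - (1 + k * t ^ 2)
  = seiffert_gap k t * ((1 + k * t ^ 2) / atan t).
Proof.
intros Hk Ht; pose proof (parabola_pos k t Hk); pose proof (atan_pos t Ht).
unfold seiffert_gap; field; lra.
Qed.

Lemma parabola_lt_of_gap_pos (k t : R) : 0 <= k -> 0 < t ->
  0 < seiffert_gap k t -> 1 + k * t ^ 2 < t / atan t.
Proof.
intros Hk Ht Hg.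
pose proof (parabola_sub_ratio k t Hk Ht) as E.
assert (0 < (1 + k * t ^ 2) / atan t)
  by (apply Rdiv_lt_0_compat; [now apply parabola_pos | now apply atan_pos]).
nra.
Qed.

Lemma parabola_gt_of_gap_neg (k t : R) : 0 <= k -> 0 < t ->
  seiffert_gap k t < 0 -> t / atan t < 1 + k * t ^ 2.
Proof.
intros Hk Ht Hg.
pose proof (parabola_sub_ratio k t Hk Ht) as E.
assert (0 < (1 + k * t ^ 2) / atan t)
  by (apply Rdiv_lt_0_compat; [now apply parabola_pos | now apply atan_pos]).
nra.
Qed.

Lemma is_derive_seiffert_gap (k t : R) : 0 <= k ->
  is_derive (seiffert_gap k) t
    (((1 - 3 * k) - k * (1 + k) * t ^ 2)
       * (t ^ 2 / ((1 + k * t ^ 2) ^ 2 * (1 + t ^ 2)))).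
Proof.
intros Hk; pose proof (parabola_pos k t Hk).
pose proof (pow2_ge_0 t).
unfold seiffert_gap; auto_derive.
- simpl in *; lra.
- unfold Rsqr in *; field; simpl in *; lra.
Qed.

(** Only the sign of the slope matters in what follows, so the positive factor
    of the derivative and the length [y - x] are hidden in [m]. *)
Lemma seiffert_gap_mean_value (k x y : R) : 0 <= k -> 0 <= x < y ->
  exists u m : R, x < u < y /\ 0 < m /\
    seiffert_gap k y - seiffert_gap k x
    = ((1 - 3 * k) - k * (1 + k) * u ^ 2) * m.
Proof.
intros Hk Hxy.
destruct (MVT_cor2 (seiffert_gap k) _ x y (proj2 Hxy)
  (fun c _ => proj1 (is_derive_Reals _ _ _) (is_derive_seiffert_gap k c Hk)))
  as [u [E Hu]].
exists u, (u ^ 2 / ((1 + k * u ^ 2) ^ 2 * (1 + u ^ 2)) * (y - x)).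
assert (0 < u ^ 2) by (apply pow_lt; lra).
assert (0 < (1 + k * u ^ 2) ^ 2) by (apply pow_lt, parabola_pos, Hk).
repeat split; try lra.
apply Rmult_lt_0_compat; [|lra].
apply Rdiv_lt_0_compat; [|apply Rmult_lt_0_compat]; lra.
Qed.

Lemma seiffert_gap_third_neg (t : R) : 0 < t -> seiffert_gap (1 / 3) t < 0.
Proof.
intros Ht.
destruct (seiffert_gap_mean_value (1 / 3) 0 t) as (u & m & Hu & Hm & E); try lra.
rewrite seiffert_gap_0 in E.
assert (0 < u ^ 2 * m)
  by (apply Rmult_lt_0_compat; [apply pow_lt|]; lra).
nra.
Qed.

Lemma seiffert_gap_pos_near_0 (k t : R) : 0 <= k -> 0 < t ->
  k * (1 + k) * t ^ 2 < 1 - 3 * k -> 0 < seiffert_gap k t.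
Proof.
intros Hk Ht Hkt.
destruct (seiffert_gap_mean_value k 0 t) as (u & m & Hu & Hm & E); try lra.
rewrite seiffert_gap_0 in E.
assert (u ^ 2 <= t ^ 2) by (apply pow_incr; lra).
assert (0 <= k * (1 + k)) by nra.
assert (0 < (1 - 3 * k) - k * (1 + k) * u ^ 2) by nra.
nra.
Qed.

(** A nonpositive value at [t] between the zeros 0 and 1 would force a
    nonpositive slope somewhere before [t] and a nonnegative one after [t],
    whereas the sign factor of the slope decreases. *)
Lemma seiffert_gap_pos_between_zeros (k t : R) : 0 < k ->
  seiffert_gap k 1 = 0 -> 0 < t < 1 -> 0 < seiffert_gap k t.
Proof.
intros Hk H1 Ht.
destruct (seiffert_gap_mean_value k 0 t) as (u & m & Hu & Hm & Eu); try lra.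
destruct (seiffert_gap_mean_value k t 1) as (v & n & Hv & Hn & Ev); try lra.
rewrite seiffert_gap_0 in Eu; rewrite H1 in Ev.
apply Rnot_le_lt; intros Hle.
assert (u ^ 2 < v ^ 2) by nra.
assert (0 < k * (1 + k)) by nra.
assert (k * (1 + k) * u ^ 2 < k * (1 + k) * v ^ 2)
  by (apply Rmult_lt_compat_l; lra).
assert ((1 - 3 * k) - k * (1 + k) * u ^ 2 <= 0) by nra.
assert (0 <= (1 - 3 * k) - k * (1 + k) * v ^ 2) by nra.
lra.
Qed.

(** * Sharp parabolas *)

(** For [k = 0] the gap is [t - atan t], so its positivity at 1 reads
    [PI / 4 < 1]. *)
Lemma four_div_PI_gt_1 : 1 < 4 / PI.
Proof.
pose proof PI_RGT_0.
assert (Hgap : 0 < seiffert_gap 0 1) by (apply seiffert_gap_pos_near_0; lra).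
unfold seiffert_gap in Hgap; rewrite atan_1 in Hgap.
replace (1 / (1 + 0 * 1 ^ 2)) with 1 in Hgap by field.
apply Rmult_lt_reg_r with PI; [lra|].
unfold Rdiv; rewrite Rmult_assoc, Rinv_l; lra.
Qed.

Lemma seiffert_gap_four_div_PI_at_1 : seiffert_gap (4 / PI - 1) 1 = 0.
Proof.
pose proof PI_RGT_0; unfold seiffert_gap; rewrite atan_1; field; lra.
Qed.

(** A strict inequality on (0, 1) survives as a weak one at the end point. *)
Lemma continuity_pt_neg_left_le (f : R -> R) : continuity_pt f 1 ->
  (forall t, 0 < t < 1 -> f t < 0) -> f 1 <= 0.
Proof.
intros Hc Hneg; apply Rnot_lt_le; intros Hpos.
destruct (Hc (f 1) Hpos) as (d & Hd & Hlim).
pose proof (Rmin_l (d / 2) (1 / 2)); pose proof (Rmin_r (d / 2) (1 / 2)).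
assert (0 < Rmin (d / 2) (1 / 2)) by (apply Rmin_glb_lt; lra).
set (t := 1 - Rmin (d / 2) (1 / 2)) in *.
assert (Ht : 0 < t < 1) by (unfold t; lra).
specialize (Hlim t); simpl in Hlim; unfold Rdist, D_x, no_cond in Hlim.
assert (Hdist : Rabs (f t - f 1) < f 1).
{ apply Hlim; repeat split; try lra.
  rewrite Rabs_left; unfold t; lra. }
specialize (Hneg t Ht).
rewrite Rabs_left in Hdist; lra.
Qed.

Lemma parabola_lower_bound_coeff_le (k : R) :
  (forall t, 0 < t < 1 -> 1 + k * t ^ 2 < t / atan t) -> k <= 4 / PI - 1.
Proof.
intros H.
assert (Hend : (1 + k * 1 ^ 2) * atan 1 - 1 <= 0).
{ apply (continuity_pt_neg_left_le (fun t => (1 + k * t ^ 2) * atan t - t)).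
  - apply derivable_continuous_pt, ex_derive_Reals_0.
    auto_derive; exact I.
  - intros t Ht; specialize (H t Ht).
    pose proof (atan_pos t (proj1 Ht)) as Ha.
    apply (Rmult_lt_compat_r _ _ _ Ha) in H.
    replace (t / atan t * atan t) with t in H by (field; lra).
    lra. }
rewrite atan_1 in Hend; pose proof PI_RGT_0.
apply Rmult_le_reg_r with PI; [lra|].
replace ((4 / PI - 1) * PI) with (4 - PI) by (field; lra).
lra.
Qed.

Lemma parabola_upper_bound_coeff_ge (k : R) :
  (forall t, 0 < t < 1 -> t / atan t < 1 + k * t ^ 2) -> 1 / 3 <= k.
Proof.
intros H; apply Rnot_lt_le; intros Hk.
(* A negative [k] is replaced by 0, which keeps the upper bound and makes the
   sign analysis of the gap available. *)
set (k' := Rmax k 0).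
assert (Hk' : 0 <= k' < 1 / 3)
  by (split; [apply Rmax_r | apply Rmax_lub_lt; lra]).
(* Since [k' (1 + k') < 4/9] and [t^2 < t], the subtracted term
   [k' (1 + k') t^2] stays below [1 - 3 k' = 2 t], so the gap is still
   increasing up to this [t]. *)
set (t := (1 - 3 * k') / 2).
assert (Ht : 0 < t < 1) by (unfold t; lra).
assert (Hlow : 1 + k' * t ^ 2 < t / atan t).
{ apply parabola_lt_of_gap_pos; try lra.
  apply seiffert_gap_pos_near_0; try lra.
  replace (1 - 3 * k') with (2 * t) by (unfold t; field).
  assert (k' * (1 + k') <= 1) by nra.
  assert (0 < t ^ 2 < t) by nra.
  nra. }
specialize (H t Ht).
assert (k * t ^ 2 <= k' * t ^ 2)
  by (apply Rmult_le_compat_r; [apply pow2_ge_0 | apply Rmax_l]).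
lra.
Qed.

Theorem theorem5p1 (alpha beta : R) :
  (forall a b : R, 0 < a -> 0 < b -> a <> b ->
     alpha * contraharmonic_mean a b + (1 - alpha) * harmonic_mean a b
       < second_seiffert_mean a b
       < beta * contraharmonic_mean a b + (1 - beta) * harmonic_mean a b)
  <-> alpha <= 2 / PI /\ beta >= 2 / 3.
Proof.
pose proof PI_RGT_0.
assert (E : 4 / PI = 2 * (2 / PI)) by (field; lra).
rewrite mean_bounds_iff_parabola_bounds; split.
- intros H'; split.
  + pose proof (parabola_lower_bound_coeff_le (2 * alpha - 1)
      (fun t Ht => proj1 (H' t Ht))); lra.
  + pose proof (parabola_upper_bound_coeff_ge (2 * beta - 1)
      (fun t Ht => proj2 (H' t Ht))); lra.
- intros [Ha Hb] t Ht.
  pose proof four_div_PI_gt_1.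
  pose proof (pow2_ge_0 t).
  split.
  + apply Rle_lt_trans with (1 + (4 / PI - 1) * t ^ 2); [nra|].
    apply parabola_lt_of_gap_pos; try lra.
    apply seiffert_gap_pos_between_zeros; try lra.
    exact seiffert_gap_four_div_PI_at_1.
  + apply Rlt_le_trans with (1 + 1 / 3 * t ^ 2); [|nra].
    apply parabola_gt_of_gap_neg; try lra.
    apply seiffert_gap_third_neg; lra.
Qed.
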